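(* For every positive integer $t$ there is a constant $C_t$ such that the following holds for every integer $d\ge1$. If $\nu$ is a measure on $\mathbb{R}^d$, with respect to which all polynomials are integrable, that is symmetric with respect to coordinate permutations and coordinate negations, then there is a signed $\mathcal{P}^o_{2t}$-design for $\nu$ with at most $C_t\,d^t$ points.
   Context: For $\alpha=(\alpha_1,\dots,\alpha_d)\in\mathbb{N}_0^d$ write $x^\alpha=x_1^{\alpha_1}\cdots x_d^{\alpha_d}$ and $|\alpha|=\alpha_1+\cdots+\alpha_d$. Let $\mathcal{P}^o_{2t}$ denote the linear span of the monomials $x^\alpha$ in $d$ variables for which either $|\alpha|\le 2t$ or some component $\alpha_i$ is odd. A signed $\mathcal{P}^o_{2t}$-design for $\nu$ is a finite set $X\subset\mathbb{R}^d$ with a function $w\colon X\to\mathbb{R}$ such that $\sum_{x\in X}w(x)f(x)=\int_{\mathbb{R}^d}f\,d\nu$ for every $f\in\mathcal{P}^o_{2t}$. Symmetric with respect to coordinate permutations and negations means that $\nu$ is invariant under every map permuting the coordinates and every map $x_i\mapsto -x_i$ negating a single coordinate. *)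

(* Defs.v *)
From HB Require Import structures.
From mathcomp Require Import all_boot all_order all_algebra all_fingroup.
From mathcomp Require Import finmap.
From mathcomp Require Import all_classical all_reals all_analysis.

Set Implicit Arguments.
Unset Strict Implicit.
Unset Printing Implicit Defensive.

Import Order.TTheory GRing.Theory Num.Theory.

Local Open Scope classical_set_scope.
Local Open Scope ring_scope.

(* R^d is [d.-tuple R] with the product of the Borel sigma-algebras on R, that
   is, the Borel sigma-algebra of R^d. *)

Definition lspan (K : nzRingType) (V : lmodType K) (A : set V) : set V :=
  [set v | exists (n : nat) (a : 'I_n -> K) (u : 'I_n -> V),
     (forall i, A (u i)) /\ v = \sum_(i < n) a i *: u i].

Section Designs.
Context {R : realType} {d : nat}.

(* The codomain is R^o so that functions form a vector space over R. *)
Definition monomial (alpha : 'I_d -> nat) : d.-tuple R -> R^o :=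
  fun x => \prod_(i < d) tnth x i ^+ alpha i.

Definition polynomials : set (d.-tuple R -> R^o) := lspan (range monomial).

Definition odd_poly_space (m : nat) : set (d.-tuple R -> R^o) :=
  lspan [set monomial alpha | alpha in
    [set alpha : 'I_d -> nat |
       (\sum_(i < d) alpha i <= m)%N \/ exists i, odd (alpha i)]].

Definition permute_coords (s : 'S_d) (x : d.-tuple R) : d.-tuple R :=
  [tuple tnth x (s i) | i < d].

Definition negate_coord (i : 'I_d) (x : d.-tuple R) : d.-tuple R :=
  [tuple (if j == i then - tnth x j else tnth x j) | j < d].

(* The values of a measure outside the measurable sets are irrelevant. *)
Definition invariant_under (nu : {measure set (d.-tuple R) -> \bar R})
    (g : d.-tuple R -> d.-tuple R) : Prop :=
  forall A, measurable A -> pushforward nu g A = nu A.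

Definition symmetric_measure (nu : {measure set (d.-tuple R) -> \bar R}) :
    Prop :=
  (forall s : 'S_d, invariant_under nu (permute_coords s)) /\
  (forall i : 'I_d, invariant_under nu (negate_coord i)).

Definition signed_design (nu : {measure set (d.-tuple R) -> \bar R})
    (F : set (d.-tuple R -> R^o)) (X : {fset d.-tuple R}) (w : X -> R) : Prop :=
  forall f, F f ->
    (\sum_(x : X) w x * f (fsval x))%:E = (\int[nu]_x (f x)%:E)%E.

End Designs.

(* Main.v *)
Require Import Defs.
From HB Require Import structures.
From mathcomp Require Import all_boot all_order all_algebra all_fingroup.
From mathcomp Require Import finmap.
From mathcomp Require Import all_classical all_reals all_analysis.

Set Implicit Arguments.
Unset Strict Implicit.
Unset Printing Implicit Defensive.

Import Order.TTheory GRing.Theory Num.Theory.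

Local Open Scope classical_set_scope.
Local Open Scope ring_scope.

(** The measure enters only through the linear functional [f |-> \int f dnu],
    and invariance under coordinate negations makes that functional vanish on
    every monomial with an odd exponent.  So it suffices to realize an arbitrary
    functional [m] with this vanishing property by point masses on few points.

    In one variable, on the nodes [-t, ..., t], there are for each [k <= t]
    signed weights with moment of order [j] equal to [1] for [j = 2k] and to [0]
    for every other [j] that is odd or at most [2t]
    ([exists_even_moment_weights]): inverting the Vandermonde matrix handles the
    orders up to [2t], and averaging with the reflection [v |-> -v] kills all
    odd orders at once.  For [k = 0] the unit mass at the node [0] does the job,
    and this choice is what makes the final point set small.

    Tensor products of these weights give, for each [beta] with
    [\sum_i beta i <= t], a signed combination of points of [{-t, ..., t}^d]
    that maps [x^(2 beta)] to [1] and every other monomial that has an odd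
    exponent or degree at most [2t] to [0].
    Coordinates with [beta i = 0] carry the unit mass at [0], so that
    combination only charges points with at most [t] nonzero coordinates.
    Summing over [beta] with coefficients [m (2 beta)] represents [m].  A grid
    point with at most [t] nonzero coordinates is determined by at most [t]
    pairs (coordinate, node), so there are at most [(d (2t + 1)) ^ t] of them. *)

(** * Weights in one variable *)

(** A column of the inverse of the Vandermonde matrix of the nodes. *)
Lemma exists_kronecker_moment_weights (F : fieldType) (n : nat)
    (a : 'I_n -> F) (k : 'I_n) : injective a ->
  exists c : 'I_n -> F,
    forall j : 'I_n, \sum_v c v * a v ^+ j = (j == k)%:R.
Proof.
move=> a_inj; pose M := Vandermonde n (\row_v a v).
have Mu : M \in unitmx.
  rewrite unitmxE unitfE det_Vandermonde; apply/prodf_neq0 => i _.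
  apply/prodf_neq0 => j lij; rewrite !mxE subr_eq0 (inj_eq a_inj).
  by rewrite -val_eqE /= gtn_eqF.
exists (fun v => invmx M v k) => j.
have /matrixP/(_ j k) := mulmxV Mu; rewrite !mxE => <-.
by apply: eq_bigr => v _; rewrite !mxE mulrC.
Qed.

Section OneVariable.
Context {R : realType} {t : nat}.

Definition node (v : 'I_(2 * t).+1) : R := (v : nat)%:R - t%:R.

Lemma node_inj : injective node.
Proof. by move=> u v /addIr /eqP; rewrite eqr_nat => /eqP /val_inj. Qed.

Lemma node_rev_ord v : node (rev_ord v) = - node v.
Proof.
rewrite /node /= subSS natrB; last by rewrite -ltnS.
have -> : (2 * t)%:R = t%:R + t%:R :> R by rewrite mul2n -addnn natrD.
by rewrite opprB addrAC addrK.
Qed.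

(** Odd orders are killed without any bound on [j], since a monomial with one odd
    exponent must be annihilated whatever its degree.  The clause for [k = 0]
    is what later forces the tensor products to live on sparse points. *)
Lemma exists_even_moment_weights (k : nat) : (k <= t)%N ->
  exists c : 'I_(2 * t).+1 -> R,
    (k = 0%N -> forall v, c v != 0 -> node v = 0) /\
    (forall j, odd j || (j <= 2 * t)%N ->
       \sum_v c v * node v ^+ j = (j == 2 * k)%N%:R).
Proof.
case: k => [_|k kt].
  exists (fun v => (node v == 0)%:R); split=> [_ v|j _].
    by have [//|_] := eqVneq (node v) 0; rewrite eqxx.
  have tn : (t < (2 * t).+1)%N by rewrite ltnS leq_pmull.
  have n0 : node (Ordinal tn) = 0 by rewrite /node /= subrr.
  rewrite (bigD1 (Ordinal tn)) //= n0 eqxx mul1r expr0n muln0 big1 ?addr0 //.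
  by move=> v vt; rewrite -n0 (inj_eq node_inj) (negPf vt) mul0r.
have k2 : (2 * k.+1 < (2 * t).+1)%N by rewrite ltnS leq_pmul2l.
have [c cP] := exists_kronecker_moment_weights (Ordinal k2) node_inj.
exists (fun v => (c v + c (rev_ord v)) / 2); split=> // j jP.
(* Reflecting the nodes multiplies the moment of order j by (-1)^j. *)
have -> : \sum_v (c v + c (rev_ord v)) / 2 * node v ^+ j =
    (\sum_v c v * node v ^+ j + (-1) ^+ j * \sum_v c v * node v ^+ j) / 2.
  under eq_bigr do rewrite mulrAC mulrDl.
  rewrite -mulr_suml big_split /=; congr ((_ + _) / 2).
  rewrite (reindex_inj rev_ord_inj) mulr_sumr /=; apply: eq_bigr => v _.
  by rewrite rev_ordK node_rev_ord (exprNn (node v)) mulrCA.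
rewrite -signr_odd; have [oj|ej] := boolP (odd j).
  rewrite expr1 mulN1r subrr mul0r; case: eqP => // j2.
  by move: oj; rewrite j2 oddM.
have jt : (j < (2 * t).+1)%N by move: jP; rewrite (negPf ej).
by rewrite expr0 mul1r (cP (Ordinal jt)) mulrDl -splitr.
Qed.

End OneVariable.

(** * Sparse grid points *)

Section SparseGrid.
Context {R : realType} {t d : nat}.
Local Notation V := 'I_(2 * t).+1.

Definition grid_point (g : 'I_d -> V) : d.-tuple R :=
  [tuple node (g i) | i < d].

(** Coordinates listed twice by [h] take the value of whichever entry is picked;
    only an upper bound on the number of points is at stake, so that redundancy
    is harmless. *)
Definition sparse_point (h : {ffun 'I_t -> 'I_d * V}) : d.-tuple R :=
  [tuple (if [pick a | (h a).1 == i] is Some a then node (h a).2 else 0)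
     | i < d].

Definition sparse_grid : {fset d.-tuple R} :=
  [fset sparse_point h | h in {ffun 'I_t -> 'I_d * V}]%fset.

Lemma card_sparse_grid : (#|` sparse_grid| <= (d * (2 * t).+1) ^ t)%N.
Proof.
apply: leq_trans (leq_imfset_card _ _ _) _.
by rewrite /= -cardE card_ffun card_prod !card_ord.
Qed.

Lemma grid_point_sparse (g : 'I_d -> V) (S : {set 'I_d}) : (0 < d)%N ->
  (#|S| <= t)%N -> (forall i, i \notin S -> node (g i) = 0 :> R) ->
  grid_point g \in sparse_grid.
Proof.
move=> d_gt0 St g0; pose e (a : 'I_t) := nth (Ordinal d_gt0) (enum S) a.
apply/imfsetP; exists [ffun a => (e a, g (e a))] => //.
apply: eq_from_tnth => i; rewrite !tnth_mktuple.
case: pickP => [a|noa]; first by rewrite ffunE /= => /eqP ->.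
apply: g0; apply/negP => iS.
have lt_i : (index i (enum S) < t)%N.
  by apply: leq_trans St; rewrite cardE index_mem mem_enum.
have := noa (Ordinal lt_i).
by rewrite ffunE /= /e nth_index ?mem_enum // eqxx.
Qed.

End SparseGrid.

(** * Realizing a functional on the sparse grid *)

(** The image of a signed combination of point masses: masses sent to the same
    point add up, and indices of weight zero may be sent outside [X]. *)
Lemma exists_weights_on_fset (K : pzRingType) (T : choiceType) (J : finType)
    (c : J -> K) (p : J -> T) (X : {fset T}) :
  (forall j, c j != 0 -> p j \in X) ->
  exists w : X -> K, forall f : T -> K,
    \sum_(x : X) w x * f (fsval x) = \sum_j c j * f (p j).
Proof.
move=> cX; exists (fun x => \sum_(j | p j == fsval x) c j) => f.
under eq_bigr do rewrite mulr_suml big_mkcond.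
rewrite exchange_big /=; apply: eq_bigr => j _; rewrite -big_mkcond /=.
have [cj0|/cX pjX] := eqVneq (c j) 0.
  by rewrite cj0 mul0r big1 // => x _; rewrite mul0r.
by rewrite (big_pred1 [` pjX]%fset).
Qed.

Section Interpolation.
Context {R : realType} {t d : nat}.
Local Notation V := 'I_(2 * t).+1.

Lemma sum_tensor_weights (c : 'I_d -> V -> R) (alpha : 'I_d -> nat) :
  \sum_(g : {ffun 'I_d -> V}) (\prod_i c i (g i)) * monomial alpha (grid_point g)
  = \prod_i \sum_v c i v * node v ^+ alpha i.
Proof.
rewrite bigA_distr_bigA; apply: eq_bigr => g _.
rewrite /monomial -big_split /=; apply: eq_bigr => i _.
by rewrite tnth_mktuple.
Qed.

(** The weight of a grid point is
    [\sum_beta m (2 beta) * \prod_i kappa (beta i) (g i)].  If it is nonzero,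
    so is some term, and then the coordinates of the point outside the support
    of [beta], of size at most [\sum_i beta i <= t], vanish. *)
Lemma exists_sparse_grid_weights (m : ('I_d -> nat) -> R) : (0 < d)%N ->
  (forall alpha, (exists i, odd (alpha i)) -> m alpha = 0) ->
  exists w : sparse_grid (R := R) (t := t) (d := d) -> R,
    forall alpha : 'I_d -> nat,
      (\sum_i alpha i <= 2 * t)%N \/ (exists i, odd (alpha i)) ->
      \sum_x w x * monomial alpha (fsval x) = m alpha.
Proof.
move=> d_gt0 m_odd.
have [kappa kappaP] := choice (fun k : 'I_t.+1 =>
  exists_even_moment_weights (R := R) (ltn_ord k : (k <= t)%N)).
pose B : pred {ffun 'I_d -> 'I_t.+1} := fun beta => (\sum_i beta i <= t)%N.
pose c (g : {ffun 'I_d -> V}) := \sum_(beta | B beta)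
  m (fun i => 2 * beta i)%N * \prod_i kappa (beta i) (g i).
have c_sparse g : c g != 0 ->
    grid_point (R := R) g \in sparse_grid (R := R) (t := t) (d := d).
  move=> cg; have [beta Bbeta kg] : exists2 beta, B beta &
      \prod_i kappa (beta i) (g i) != 0.
    apply: contrapT => nex; move/negP: cg; apply; apply/eqP.
    apply: big1 => beta Bbeta.
    have [->|kg] := eqVneq (\prod_i kappa (beta i) (g i)) 0.
      by rewrite mulr0.
    by case: nex; exists beta.
  apply: (@grid_point_sparse R t d g [set i | beta i != 0%N :> nat]%SET) => //.
    apply: leq_trans Bbeta; rewrite -sum1_card big_mkcond /=.
    by apply: leq_sum => i _; rewrite inE; case: (nat_of_ord (beta i)).
  move=> i; rewrite inE negbK => /eqP bi0.
  apply: (kappaP (beta i)).1 => //.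
  by move/prodf_neq0: kg; apply.
have [w wP] := exists_weights_on_fset c_sparse.
exists w => alpha alphaP; rewrite wP.
under eq_bigr do rewrite /c mulr_suml.
rewrite exchange_big /=.
under eq_bigr => beta _.
  under eq_bigr do rewrite -mulrA.
  rewrite -mulr_sumr (sum_tensor_weights (fun i => kappa (beta i))).
  over.
(* The factor of an odd exponent kills every tensor product. *)
have [[i0 oi0]|no_odd] := pselect (exists i, odd (alpha i)).
  rewrite m_odd; last by exists i0.
  apply: big1 => beta _; rewrite (bigD1 i0) //= (kappaP _).2 ?oi0 //.
  case: eqP => [e|_]; last by rewrite mul0r mulr0.
  by move: oi0; rewrite e oddM.
case: alphaP => [alpha_le|//].
have alpha_even i : ~~ odd (alpha i) by apply/negP => ?; apply: no_odd; exists i.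
have alpha2 i : (2 * (alpha i)./2 = alpha i)%N.
  by rewrite mul2n even_halfK.
have half_le : (\sum_i (alpha i)./2 <= t)%N.
  rewrite -(leq_pmul2l (isT : 0 < 2)%N) big_distrr /=.
  by under eq_bigr do rewrite alpha2.
have alphai_le i : (alpha i <= 2 * t)%N.
  by apply: leq_trans alpha_le; rewrite (bigD1 i) //= leq_addr.
have half_lt i : ((alpha i)./2 < t.+1)%N.
  by rewrite ltnS -(leq_pmul2l (isT : 0 < 2)%N) alpha2.
(* Now alpha = 2 gamma, and only the term beta = gamma survives. *)
pose gamma : {ffun 'I_d -> 'I_t.+1} := [ffun i => Ordinal (half_lt i)].
have Bgamma : B gamma.
  by rewrite /B; under eq_bigr do rewrite ffunE.
have moment (beta : {ffun 'I_d -> 'I_t.+1}) :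
    \prod_i \sum_v kappa (beta i) v * node v ^+ alpha i =
    (beta == gamma)%:R.
  under eq_bigr do rewrite (kappaP _).2 ?alphai_le ?orbT // -alpha2 eqn_pmul2l //.
  have [->|/eqP neq] := eqVneq beta gamma.
    by apply: big1 => i _; rewrite ffunE eqxx.
  have [i neqi] : exists i, beta i != gamma i.
    apply: contrapT => nex; apply: neq; apply/ffunP => i.
    by apply/eqP/negP => /negP ?; apply: nex; exists i.
  rewrite (bigD1 i) //=; case: eqP => [e|_]; last by rewrite mul0r.
  by move/eqP: neqi; case; apply: val_inj; rewrite ffunE.
rewrite (bigD1 gamma) //= moment eqxx mulr1 big1 ?addr0; last first.
  by move=> beta /andP[_ /negPf neq]; rewrite moment neq mulr0.
by congr m; apply: funext => i; rewrite ffunE alpha2.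
Qed.

End Interpolation.

(** * Moments of a symmetric measure *)

Section Moments.
Context {R : realType} {d : nat}.
Implicit Types (alpha : 'I_d -> nat) (nu : {measure set (d.-tuple R) -> \bar R}).

Lemma polynomials_monomial alpha :
  polynomials (monomial alpha : d.-tuple R -> R^o).
Proof.
exists 1%N, (fun=> 1), (fun=> monomial alpha); split=> [_|]; first by exists alpha.
by rewrite big_ord1 scale1r.
Qed.

Lemma measurable_negate_coord (i : 'I_d) :
  measurable_fun [set: d.-tuple R] (negate_coord i).
Proof.
apply/measurable_fun_tnthP => j.
apply: (eq_measurable_fun
  (fun x : d.-tuple R => if j == i then - tnth x j else tnth x j)).
  by move=> x _ /=; rewrite tnth_mktuple.
case: (j == i); last exact: measurable_tnth.
by apply: measurableT_comp => //; exact: measurable_tnth.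
Qed.

Lemma monomial_negate_coord alpha (i : 'I_d) (x : d.-tuple R) :
  odd (alpha i) -> monomial alpha (negate_coord i x) = - monomial alpha x.
Proof.
move=> oi; rewrite /monomial (bigD1 i) //= [in RHS](bigD1 i) //=.
rewrite tnth_mktuple eqxx exprNn -signr_odd oi expr1 mulN1r mulNr.
congr (- (_ * _)); apply: eq_bigr => j /negPf ji.
by rewrite tnth_mktuple ji.
Qed.

(** Negating the [i]-th coordinate changes the sign of the monomial but not its
    integral. *)
Lemma integral_odd_monomial nu alpha (i : 'I_d) :
  nu.-integrable [set: d.-tuple R] (EFin \o monomial alpha) ->
  invariant_under nu (negate_coord i) -> odd (alpha i) ->
  (\int[nu]_x (monomial alpha x)%:E = 0)%E.
Proof.
move=> mint inv oi.
have negE : (EFin \o monomial alpha) \o negate_coord i =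
    (fun x : d.-tuple R => - (monomial alpha x)%:E)%E.
  by apply: funext => x /=; rewrite monomial_negate_coord // EFinN.
have : (\int[nu]_x (monomial alpha x)%:E =
        - \int[nu]_x (monomial alpha x)%:E)%E.
  rewrite -[in RHS]integralN /=; last first.
    by apply: integrable_add_def.
  rewrite -negE.
  have := @integral_pushforward _ _ _ _ R _ (measurable_negate_coord i) nu
    setT (EFin \o monomial alpha).
  rewrite preimage_setT => <- //.
  - apply: eq_measure_integral => [|mneg A mA _]; last exact/esym/inv.
    exact: measurable_negate_coord.
  - exact: measurable_int mint.
  - by rewrite negE; exact: integrableN.
have /fineK <- := integrable_fin_num measurableT mint.
move=> [/eqP]; rewrite -addr_eq0 -mulr2n mulrn_eq0 /= => /eqP e.
by rewrite /= e.
Qed.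

(** Both sides of the design equation are linear on integrable functions. *)
Lemma signed_design_lspan nu (A : set ('I_d -> nat)) (X : {fset d.-tuple R})
    (w : X -> R) :
  (forall alpha, nu.-integrable [set: d.-tuple R] (EFin \o monomial alpha)) ->
  (forall alpha, A alpha -> (\sum_(x : X) w x * monomial alpha (fsval x))%:E =
     (\int[nu]_x (monomial alpha x)%:E)%E) ->
  signed_design nu (lspan [set monomial alpha | alpha in A]) w.
Proof.
move=> mint wA _ [n [a [u [uA ->]]]].
have uint k : nu.-integrable [set: d.-tuple R] (EFin \o u k).
  by have [alpha _ <-] := uA k; exact: mint.
have sumE x : ((\sum_(k < n) a k *: u k) x)%:E =
    (\sum_(k < n) (a k)%:E * (u k x)%:E)%E.
  by rewrite fct_sumE -sumEFin; apply: eq_bigr => k _.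
under eq_integral do rewrite sumE.
rewrite (@integral_sum _ _ _ _ _ measurableT _
  (fun k x => ((a k)%:E * (u k x)%:E)%E)); last first.
  by move=> k; apply: (integrableZl measurableT); exact: uint.
have intE k : (\int[nu]_x ((a k)%:E * (u k x)%:E) =
    (a k * \sum_(x : X) w x * u k (fsval x))%:E)%E.
  rewrite (integralZl measurableT); last exact: uint.
  by have [alpha Aalpha <-] := uA k; rewrite -wA // EFinM.
rewrite (eq_bigr _ (fun k _ => intE k)) sumEFin; congr (_%:E).
under [RHS]eq_bigr do rewrite mulr_sumr.
rewrite exchange_big /=; apply: eq_bigr => x _.
by rewrite fct_sumE mulr_sumr; apply: eq_bigr => k _; rewrite mulrCA.
Qed.

End Moments.

Theorem theorem5p4 (R : realType) (t : nat) (t_gt0 : (0 < t)%N) :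
  exists C : R, forall (d : nat) (d_gt0 : (1 <= d)%N)
    (nu : {measure set (d.-tuple R) -> \bar R}),
    (forall p, polynomials p -> nu.-integrable [set: d.-tuple R] (EFin \o p)) ->
    symmetric_measure nu ->
    exists (X : {fset d.-tuple R}) (w : X -> R),
      signed_design nu (odd_poly_space (2 * t)) w /\
      (#|` X|)%:R <= C * d%:R ^+ t.
Proof.
exists ((2 * t).+1%:R ^+ t) => d d_gt0 nu pint [_ nu_neg].
have mint alpha : nu.-integrable [set: d.-tuple R] (EFin \o monomial alpha).
  exact/pint/polynomials_monomial.
pose m alpha := fine (\int[nu]_x (monomial alpha x)%:E)%E.
have m_odd alpha : (exists i, odd (alpha i)) -> m alpha = 0.
  by case=> i oi; rewrite /m (integral_odd_monomial (mint _) (nu_neg i) oi).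
have [w wP] := exists_sparse_grid_weights (t := t) d_gt0 m_odd.
exists sparse_grid, w; split.
  apply: signed_design_lspan => // alpha alphaP.
  by rewrite wP // /m fineK //; exact: integrable_fin_num (mint alpha).
by rewrite -exprMn mulrC -natrM -natrX ler_nat card_sparse_grid.
Qed.
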